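(* Consider the constrained problem $\min_{x\in X}f_0(x)$ subject to $f_i(x)\le0$, $i=1,\dots,m$, with optimal value $f_0^*$, as described in the context, and suppose that the strong duality, dual function smoothness (with constant $L$) and Slater assumptions stated in the context hold. Let $\mu>0$, $\tilde L:=L+\mu$, and run the algorithm AR-CO (described in the context) for $T$ iterations with $$\alpha=\sqrt{\tfrac{\mu}{2\tilde L}},\qquad q=\frac{2\alpha-\mu/\tilde L}{2-\mu/\tilde L},\qquad\eta=\frac{\alpha}{\mu(1-\alpha)},\qquad B=\frac{G}{\xi}.$$ Let $$\Delta_t:=d(\underline\lambda_t)-f_0(x_t)-\langle\underline\lambda_t,f(x_t)\rangle,\qquad\delta_t:=\widehat\nabla d_\mu(\underline\lambda_t)-\nabla d_\mu(\underline\lambda_t),$$ $$K_0(\lambda):=d_\mu(\lambda)-d_\mu(\bar\lambda_0)+\tfrac\alpha2\big(\mu+\tfrac1\eta\big)\|\lambda_0-\lambda\|_2^2,$$ $$\tilde\zeta_T:=2\Big(1-\sqrt{\tfrac{\mu}{2\tilde L}}\Big)^{T/2}\sqrt{\eta K_0(\lambda^*_\mu)}+\sqrt{\tfrac{8\eta\sqrt mG}{\xi}\max_{t\in[T]}\|\delta_t\|_2}.$$ Then the random output $\tilde x$ satisfies $$\mathbb E[f_0(\tilde x)]-f_0^*\le\tilde\zeta_T\Big(2\sqrt mG+\tfrac{2\sqrt mG}{\eta\xi}\Big)+\sqrt{\tfrac{2\tilde L}{\mu}}\max_{t\in[T]}|\Delta_t|+\tfrac{6\mu mG^2}{\xi^2}$$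 and $$\|\mathbb E[f(\tilde x)]_+\|_1\le\tilde\zeta_T\Big(2\sqrt m\,\xi+\tfrac{2\sqrt m}{\eta}\Big)+\sqrt{\tfrac{2\tilde L}{\mu}}\,\tfrac{\max_{t\in[T]}|\Delta_t|}{B}+\tfrac{6\mu mG}{\xi}+2mG\Big(1-\sqrt{\tfrac{\mu}{2\tilde L}}\Big)^{T-1}.$$
   Context: **Problem.** $X\subseteq\mathbb R^n$ is a nonempty closed convex set and $f_0,\dots,f_m$ are (possibly nonconvex) real functions on $X$ with $|f_i(x)|\le G$ for all $x\in X$, $i=0,\dots,m$. $f(x):=(f_1(x),\dots,f_m(x))^\top$. The Lagrangian is $\mathcal L(x,\lambda):=f_0(x)+\sum_{i=1}^m\lambda_if_i(x)$, the dual function $d(\lambda):=\min_{x\in X}\mathcal L(x,\lambda)$, $d^*:=\max_{\lambda\in\mathbb R^m_+}d(\lambda)$. For $\mu>0$, $d_\mu(\lambda):=d(\lambda)-\frac\mu2\|\lambda\|_2^2$ and $\lambda^*_\mu:=\operatorname{argmax}_{\lambda\in\mathbb R^m_+}d_\mu(\lambda)$. $(\cdot)_+$ is the entrywise positive part ($\mathbb E[f(\tilde x)]_+$ is the positive part of the vector $\mathbb E[f(\tilde x)]$), $[T]=\{1,\dots,T\}$. **Strong duality.** $f_0^*=d^*$. **Dual function smoothness.** For each $\lambda\in\mathbb R^m_+$ the Lagrangian has a unique minimizer $x^*_\lambda:=\operatorname{argmin}_{x\in X}\mathcal L(x,\lambda)$, $\nabla d(\lambda)=f(x^*_\lambda)$,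 and $\|\nabla d(\lambda)-\nabla d(\lambda')\|_2=\|f(x^*_\lambda)-f(x^*_{\lambda'})\|_2\le L\|\lambda-\lambda'\|_2$ for all $\lambda,\lambda'\in\mathbb R^m_+$. **Slater's condition.** There exist $\xi>0$ and $x_\xi\in X$ with $f_i(x_\xi)\le-\xi$ for all $i=1,\dots,m$. **Algorithm AR-CO.** Let $\Lambda:=\{\lambda\in\mathbb R^m_+:\lambda_i\le2B,\ i=1,\dots,m\}$ and $\lambda_0=\bar\lambda_0=0$. For $t=1,\dots,T$: $\underline\lambda_t=(1-q)\bar\lambda_{t-1}+q\lambda_{t-1}$; $x_t=\mathrm{LagOPT}(\delta,\underline\lambda_t)\in X$, where LagOPT is an optimizer that solves $\min_{x\in X}\mathcal L(x,\underline\lambda_t)$ to prescribed accuracy $\delta>0$; $\widehat\nabla d_\mu(\underline\lambda_t)=f(x_t)-\mu\underline\lambda_t$; $\lambda_t=\operatorname{argmin}_{\lambda\in\Lambda}\{\eta[\langle-\widehat\nabla d_\mu(\underline\lambda_t),\lambda\rangle+\frac\mu2\|\lambda-\underline\lambda_t\|_2^2]+\frac12\|\lambda-\lambda_{t-1}\|_2^2\}$; $\bar\lambda_t=(1-\alpha)\bar\lambda_{t-1}+\alpha\lambda_t$. Output: $\tilde x=x_1$ with probability $(1-\alpha)^{T-1}$ and $\tilde x=x_i$ with probability $\alpha(1-\alpha)^{T-i}$ for $i=2,\dots,T$; expectations are over this choice. *)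

(* Defs.v *)
From HB Require Import structures.
From mathcomp Require Import all_boot all_order all_algebra.
From mathcomp Require Import all_classical all_reals all_analysis.
Set Implicit Arguments.
Unset Strict Implicit.
Unset Printing Implicit Defensive.
Import Order.TTheory GRing.Theory Num.Theory numFieldNormedType.Exports.
Local Open Scope classical_set_scope.
Local Open Scope ring_scope.

Definition dotv (R : realType) (m : nat) (u v : 'rV[R]_m) : R :=
  \sum_(i < m) u ord0 i * v ord0 i.

(* The library norm `|v| on 'rV[R]_m is the sup norm. *)
Definition norm2 (R : realType) (m : nat) (v : 'rV[R]_m) : R :=
  Num.sqrt (\sum_(i < m) v ord0 i ^+ 2).

Definition norm1 (R : realType) (m : nat) (v : 'rV[R]_m) : R :=
  \sum_(i < m) `|v ord0 i|.

Definition pospart (R : realType) (m : nat) (v : 'rV[R]_m) : 'rV[R]_m :=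
  \row_(i < m) Num.max (v ord0 i) 0.

Definition orthant (R : realType) (m : nat) : set 'rV[R]_m :=
  [set v | forall i, 0 <= v ord0 i].

Definition is_argmin (R : realType) (k : nat) (A : set 'rV[R]_k)
    (h : 'rV[R]_k -> R) (a : 'rV[R]_k) : Prop :=
  A a /\ forall b, A b -> h a <= h b.

Definition is_argmax (R : realType) (k : nat) (A : set 'rV[R]_k)
    (h : 'rV[R]_k -> R) (a : 'rV[R]_k) : Prop :=
  A a /\ forall b, A b -> h b <= h a.

(* Frechet gradient at a of h regarded as a function on A: increments are
   restricted to A, so that the notion makes sense on the boundary of the
   orthant; at interior points of A it is the usual gradient. *)
Definition is_gradient (R : realType) (m : nat) (A : set 'rV[R]_m)
    (h : 'rV[R]_m -> R) (a g : 'rV[R]_m) : Prop :=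
  forall e : R, 0 < e -> \forall b \near a,
    A b -> `|h b - h a - dotv g (b - a)| <= e * norm2 (b - a).

(* Equal to 0 by convention where no gradient exists. *)
Definition gradient (R : realType) (m : nat) (A : set 'rV[R]_m)
    (h : 'rV[R]_m -> R) (a : 'rV[R]_m) : 'rV[R]_m :=
  xget 0 [set g | is_gradient A h a g].

(* The constraint functions f_1, ..., f_m are indexed by 'I_m. *)
Definition fvec (R : realType) (n m : nat) (f : 'I_m -> 'rV[R]_n -> R)
    (x : 'rV[R]_n) : 'rV[R]_m :=
  \row_(i < m) f i x.

Definition lagrangian (R : realType) (n m : nat) (f0 : 'rV[R]_n -> R)
    (f : 'I_m -> 'rV[R]_n -> R) (x : 'rV[R]_n) (lam : 'rV[R]_m) : R :=
  f0 x + \sum_(i < m) lam ord0 i * f i x.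

(* The infimum is a minimum for lam in the orthant whenever dual_smooth holds. *)
Definition dual (R : realType) (n m : nat) (X : set 'rV[R]_n)
    (f0 : 'rV[R]_n -> R) (f : 'I_m -> 'rV[R]_n -> R) (lam : 'rV[R]_m) : R :=
  inf [set lagrangian f0 f x lam | x in X].

Definition dual_opt (R : realType) (n m : nat) (X : set 'rV[R]_n)
    (f0 : 'rV[R]_n -> R) (f : 'I_m -> 'rV[R]_n -> R) : R :=
  sup [set dual X f0 f lam | lam in @orthant R m].

Definition dual_mu (R : realType) (n m : nat) (X : set 'rV[R]_n)
    (f0 : 'rV[R]_n -> R) (f : 'I_m -> 'rV[R]_n -> R) (mu : R)
    (lam : 'rV[R]_m) : R :=
  dual X f0 f lam - mu / 2 * norm2 lam ^+ 2.

Definition primal_opt (R : realType) (n m : nat) (X : set 'rV[R]_n)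
    (f0 : 'rV[R]_n -> R) (f : 'I_m -> 'rV[R]_n -> R) : R :=
  inf [set f0 x | x in [set x | X x /\ forall i, f i x <= 0]].

Definition strong_duality (R : realType) (n m : nat) (X : set 'rV[R]_n)
    (f0 : 'rV[R]_n -> R) (f : 'I_m -> 'rV[R]_n -> R) : Prop :=
  primal_opt X f0 f = dual_opt X f0 f.

Definition dual_smooth (R : realType) (n m : nat) (X : set 'rV[R]_n)
    (f0 : 'rV[R]_n -> R) (f : 'I_m -> 'rV[R]_n -> R) (L : R) : Prop :=
  exists xstar : 'rV[R]_m -> 'rV[R]_n,
    [/\ forall lam, orthant lam ->
          is_argmin X (fun x => lagrangian f0 f x lam) (xstar lam) /\
          forall y, is_argmin X (fun x => lagrangian f0 f x lam) y ->
            y = xstar lam,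
        forall lam, orthant lam ->
          is_gradient (@orthant R m) (dual X f0 f) lam (fvec f (xstar lam)) &
        forall lam lam', orthant lam -> orthant lam' ->
          norm2 (fvec f (xstar lam) - fvec f (xstar lam'))
            <= L * norm2 (lam - lam')].

Definition slater (R : realType) (n m : nat) (X : set 'rV[R]_n)
    (f : 'I_m -> 'rV[R]_n -> R) (xi : R) : Prop :=
  0 < xi /\ exists2 x, X x & forall i, f i x <= - xi.

Definition dual_box (R : realType) (m : nat) (B : R) : set 'rV[R]_m :=
  [set lam | forall i, 0 <= lam ord0 i <= 2 * B].

Definition nabla_hat (R : realType) (n m : nat) (f : 'I_m -> 'rV[R]_n -> R)
    (mu : R) (x : 'rV[R]_n) (lam : 'rV[R]_m) : 'rV[R]_m :=
  fvec f x - mu *: lam.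

(* The first T iterations of AR-CO; lam, lamu, lamb and x are the sequences
   lambda_t, underlined lambda_t, overlined lambda_t and x_t, of which lamu and
   x start at index 1.  LagOPT may return any delta-optimal point of X. *)
Record AR_CO_run (R : realType) (n m : nat) (X : set 'rV[R]_n)
    (f0 : 'rV[R]_n -> R) (f : 'I_m -> 'rV[R]_n -> R)
    (mu alpha q eta B delta : R) (T : nat)
    (lam lamu lamb : nat -> 'rV[R]_m) (x : nat -> 'rV[R]_n) : Prop := {
  run_lam0 : lam 0%N = 0;
  run_lamb0 : lamb 0%N = 0;
  run_lamu : forall t, (t < T)%N ->
    lamu t.+1 = (1 - q) *: lamb t + q *: lam t;
  run_x : forall t, (t < T)%N ->
    X (x t.+1) /\
    lagrangian f0 f (x t.+1) (lamu t.+1) <= dual X f0 f (lamu t.+1) + delta;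
  run_lam : forall t, (t < T)%N ->
    is_argmin (@dual_box R m B)
      (fun l => eta * (dotv (- nabla_hat f mu (x t.+1) (lamu t.+1)) l
                       + mu / 2 * norm2 (l - lamu t.+1) ^+ 2)
                + 1 / 2 * norm2 (l - lam t) ^+ 2)
      (lam t.+1);
  run_lamb : forall t, (t < T)%N ->
    lamb t.+1 = (1 - alpha) *: lamb t + alpha *: lam t.+1
}.

(* Probability that the output is x_t, for 1 <= t <= T. *)
Definition out_prob (R : realType) (alpha : R) (T t : nat) : R :=
  if t == 1%N then (1 - alpha) ^+ (T - 1) else alpha * (1 - alpha) ^+ (T - t).

(* Expectation of h at the random output of the algorithm. *)
Definition out_mean (R : realType) (V : lmodType R) (n : nat) (alpha : R)
    (T : nat) (x : nat -> 'rV[R]_n) (h : 'rV[R]_n -> V) : V :=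
  \sum_(1 <= t < T.+1) out_prob alpha T t *: h (x t).

(* Maximum of g over t = 1, ..., T; correct for g >= 0 and T >= 1. *)
Definition maxT (R : realType) (T : nat) (g : nat -> R) : R :=
  \big[Num.max/0]_(1 <= t < T.+1) g t.

(* Main.v *)
(* Put F = E f(x~) and let w_t = alpha (1 - alpha)^(T - t).  Each step of AR-CO is
   an accelerated gradient step for the dual, and testing it against an arbitrary
   z of the box gives, after averaging with the weights w_t, a regret inequality
   bounding E f0(x~) + <z, F> by the value of d_mu at the averaged iterate, up to
   the oracle errors.  The gradient errors contribute at most
   s = 2 sqrt(m) B max |delta_t|.

   z = 0 gives E f0(x~) - f0^* <= max |Delta_t| + s, and s is absorbed by the
   zeta term since s <= 4 m B G.

   For feasibility the values d(u_t) - <u_t, f(x_t)> replace f0(x_t), so that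
   Delta_t does not enter.  The coordinates of lambda_mu^* may come arbitrarily
   close to the bound 2 B of the box, so there need not be room to raise
   lambda_mu^* by B.  With Q = F' - mu lambda_T, where F' is the w_t-average of
   f(x_t), P = |Q_+|_1 and h = 2 B - |lambda_mu^*|_1, two choices of z give
   h P <= (1 - alpha)^T K0 + s and 2 B P <= xi h + s; hence P is at most of order
   sqrt(xi ((1 - alpha)^T K0 + s)), which is what zeta pays for. *)
Require Import Defs.
From HB Require Import structures.
From mathcomp Require Import all_boot all_order all_algebra.
From mathcomp Require Import all_classical all_reals all_analysis.
From mathcomp Require Import ring lra.
Set Implicit Arguments.
Unset Strict Implicit.
Unset Printing Implicit Defensive.
Import Order.TTheory GRing.Theory Num.Theory numFieldNormedType.Exports.
Local Open Scope classical_set_scope.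
Local Open Scope ring_scope.

(** * Inner product and Euclidean norm *)

Lemma dotvC (R : realType) (m : nat) (u v : 'rV[R]_m) : dotv u v = dotv v u.
Proof. by apply: eq_bigr => i _; rewrite mulrC. Qed.

Lemma dotvDl (R : realType) (m : nat) (u v w : 'rV[R]_m) :
  dotv (u + v) w = dotv u w + dotv v w.
Proof.
by rewrite /dotv -big_split; apply: eq_bigr => i _; rewrite mxE mulrDl.
Qed.

Lemma dotvZl (R : realType) (m : nat) (a : R) (u v : 'rV[R]_m) :
  dotv (a *: u) v = a * dotv u v.
Proof.
by rewrite /dotv mulr_sumr; apply: eq_bigr => i _; rewrite mxE mulrA.
Qed.

Lemma dotvNl (R : realType) (m : nat) (u v : 'rV[R]_m) :
  dotv (- u) v = - dotv u v.
Proof. by rewrite -scaleN1r dotvZl mulN1r. Qed.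

Lemma dotvDr (R : realType) (m : nat) (u v w : 'rV[R]_m) :
  dotv w (u + v) = dotv w u + dotv w v.
Proof. by rewrite dotvC dotvDl !(dotvC w). Qed.

Lemma dotvZr (R : realType) (m : nat) (a : R) (u v : 'rV[R]_m) :
  dotv v (a *: u) = a * dotv v u.
Proof. by rewrite dotvC dotvZl dotvC. Qed.

Lemma dotvNr (R : realType) (m : nat) (u v : 'rV[R]_m) :
  dotv v (- u) = - dotv v u.
Proof. by rewrite dotvC dotvNl dotvC. Qed.

Lemma dotv0l (R : realType) (m : nat) (v : 'rV[R]_m) : dotv 0 v = 0.
Proof. by rewrite -(scale0r 0) dotvZl mul0r. Qed.

Lemma dotvv_ge0 (R : realType) (m : nat) (v : 'rV[R]_m) : 0 <= dotv v v.
Proof. by apply: sumr_ge0 => i _; rewrite -expr2 sqr_ge0. Qed.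

Definition dotvE := (dotvDl, dotvDr, dotvZl, dotvZr, dotvNl, dotvNr).

Lemma norm2_sqr (R : realType) (m : nat) (v : 'rV[R]_m) :
  norm2 v ^+ 2 = dotv v v.
Proof.
rewrite sqr_sqrtr; last by apply: sumr_ge0 => i _; rewrite sqr_ge0.
by apply: eq_bigr => i _; rewrite expr2.
Qed.

Lemma norm2_ge0 (R : realType) (m : nat) (v : 'rV[R]_m) : 0 <= norm2 v.
Proof. exact: sqrtr_ge0. Qed.

Lemma norm2_le (R : realType) (m : nat) (c : R) (v : 'rV[R]_m) :
  0 <= c -> (forall i, `|v ord0 i| <= c) -> norm2 v <= Num.sqrt m%:R * c.
Proof.
move=> c0 vc.
rewrite -(@ler_pXn2r _ 2) ?nnegrE ?norm2_ge0 ?mulr_ge0 ?sqrtr_ge0 //.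
rewrite norm2_sqr exprMn sqr_sqrtr ?ler0n //.
rewrite (_ : _ * _ = \sum_(i < m) c ^+ 2); last first.
  by rewrite sumr_const card_ord mulr_natl.
apply: ler_sum => i _; rewrite -expr2 -real_normK ?num_real //.
by rewrite ler_pXn2r ?nnegrE.
Qed.

Lemma ler_dotv_norm2 (R : realType) (m : nat) (u v : 'rV[R]_m) :
  dotv u v <= norm2 u * norm2 v.
Proof.
have [u0|u0] := eqVneq (dotv u u) 0.
  suff -> : dotv u v = 0 by rewrite mulr_ge0 ?norm2_ge0.
  rewrite /dotv big1 // => i _.
  move/eqP: u0; rewrite psumr_eq0; last by move=> j _; rewrite -expr2 sqr_ge0.
  by move=> /allP/(_ i (mem_index_enum _)); rewrite -expr2 sqrf_eq0
    => /eqP ->; rewrite mul0r.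
have up : 0 < dotv u u by rewrite lt_def u0 dotvv_ge0.
apply: (le_trans (ler_norm _)).
rewrite -(@ler_pXn2r _ 2) ?nnegrE ?mulr_ge0 ?norm2_ge0 //.
rewrite real_normK ?num_real // exprMn !norm2_sqr.
(* Cauchy-Schwarz: this squared norm is [dotv u u] times the Gram determinant of [u] and [v]. *)
have := dotvv_ge0 (dotv u u *: v - dotv u v *: u).
rewrite !dotvE (dotvC v u).
rewrite [X in 0 <= X](_ : _ =
  dotv u u * (dotv u u * dotv v v - dotv u v ^+ 2)); last by ring.
by rewrite pmulr_rge0 // subr_ge0.
Qed.

Lemma pospart_sumE (R : realType) (m : nat) (v : 'rV[R]_m) :
  norm1 (pospart v) = \sum_i Num.max (v ord0 i) 0.
Proof.
apply: eq_bigr => i _; rewrite mxE ger0_norm //.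
by rewrite le_max lexx orbT.
Qed.

(** * The box of multipliers and the proximal step *)

Definition convex_in (R : realType) (m : nat) (A : set 'rV[R]_m) :=
  forall a u v, 0 <= a <= 1 -> A u -> A v -> A ((1 - a) *: u + a *: v).

Lemma dual_box_convex (R : realType) (m : nat) (B : R) :
  convex_in (@dual_box R m B).
Proof.
move=> a u v /andP[a0 a1] Au Av i; rewrite !mxE.
have /andP[u0 u1] := Au i; have /andP[v0 v1] := Av i.
apply/andP; split; nra.
Qed.

Lemma dual_box_orthant (R : realType) (m : nat) (B : R) (v : 'rV[R]_m) :
  dual_box B v -> orthant v.
Proof. by move=> Bv i; case/andP: (Bv i). Qed.

(* The objective is eta (mu + 1/eta)-strongly convex and has no other
   curvature, so its minimizer has the matching quadratic growth. *)
Lemma prox_three_point (R : realType) (m : nat) (A : set 'rV[R]_m)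
    (g u l p l' : 'rV[R]_m) (mu eta : R) :
  convex_in A -> A l' -> 0 < mu -> 0 < eta ->
  is_argmin A (fun z => eta * (dotv (- g) z + mu / 2 * norm2 (z - u) ^+ 2)
                + 1 / 2 * norm2 (z - l) ^+ 2) p ->
  dotv g l' - mu / 2 * dotv (l' - u) (l' - u)
    - 1 / (2 * eta) * dotv (l' - l) (l' - l)
    + (mu + 1 / eta) / 2 * dotv (l' - p) (l' - p)
  <= dotv g p - mu / 2 * dotv (p - u) (p - u)
    - 1 / (2 * eta) * dotv (p - l) (p - l).
Proof.
move=> cA Al' mu0 eta0 [Ap pmin].
pose h z := eta * (dotv (- g) z + mu / 2 * dotv (z - u) (z - u))
                + 1 / 2 * dotv (z - l) (z - l).
pose D := dotv (l' - p) (l' - p).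
have key t : 0 < t <= 1 -> (1 - t) * ((eta * mu + 1) / 2 * D) <= h l' - h p.
  move=> /andP[t0 t1].
  have /pmin : A ((1 - t) *: p + t *: l') by apply: cA => //; rewrite ltW.
  rewrite !norm2_sqr -/(h p) -/(h ((1 - t) *: p + t *: l')).
  have -> : h ((1 - t) *: p + t *: l') =
      h p + t * ((h l' - h p) - (1 - t) * ((eta * mu + 1) / 2 * D)).
    rewrite /h /D !dotvE (dotvC l p) (dotvC u p) (dotvC l' p) (dotvC l' l)
      (dotvC l' u).
    by field.
  by rewrite lerDl pmulr_rge0 // subr_ge0.
have {key} : (eta * mu + 1) / 2 * D <= h l' - h p.
  rewrite leNgt; apply/negP => lt.
  set c := (eta * mu + 1) / 2 * D in lt key.
  set e := h l' - h p in lt key.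
  have e0 : 0 <= e by have := key 1; rewrite ltr01 lexx subrr mul0r; apply.
  have c0 : 0 < c by apply: le_lt_trans lt.
  (* This value of [t] replaces the limit t -> 0: it makes [(1 - t) * c] equal to [(c + e) / 2],
     which exceeds [e] when [e < c]. *)
  have /key : 0 < (c - e) / (2 * c) <= 1.
    apply/andP; split.
      by apply: divr_gt0; [rewrite subr_gt0 | apply: mulr_gt0].
    rewrite ler_pdivrMr; [lra | exact: mulr_gt0].
  have -> : (1 - (c - e) / (2 * c)) * c = (c + e) / 2.
    by field; rewrite gt_eqF.
  lra.
rewrite /h -/D dotvNl dotvNl => H.
rewrite -subr_ge0 -(pmulr_rge0 _ eta0).
set a := dotv g _ in H *; set b := dotv g p in H *.
set c1 := dotv (l' - u) _ in H *; set c2 := dotv (p - u) _ in H *.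
set c3 := dotv (l' - l) _ in H *; set c4 := dotv (p - l) _ in H *.
rewrite [X in 0 <= X](_ : _ = eta * (- a + mu / 2 * c1) + 1 / 2 * c3
  - (eta * (- b + mu / 2 * c2) + 1 / 2 * c4) - (eta * mu + 1) / 2 * D).
  by rewrite subr_ge0.
by field; rewrite gt_eqF.
Qed.

(** * Bounds on the dual function *)

Lemma lagrangianE (R : realType) (n m : nat) (f0 : 'rV[R]_n -> R)
    (f : 'I_m -> 'rV[R]_n -> R) (x : 'rV[R]_n) (lam : 'rV[R]_m) :
  lagrangian f0 f x lam = f0 x + dotv lam (fvec f x).
Proof. by congr (_ + _); apply: eq_bigr => i _; rewrite mxE. Qed.

Lemma dual_argmin (R : realType) (n m : nat) (X : set 'rV[R]_n)
    (f0 : 'rV[R]_n -> R) (f : 'I_m -> 'rV[R]_n -> R) (lam : 'rV[R]_m)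
    (y : 'rV[R]_n) :
  is_argmin X (fun x => lagrangian f0 f x lam) y ->
  dual X f0 f lam = f0 y + dotv lam (fvec f y).
Proof.
move=> [Xy ymin]; rewrite -lagrangianE; apply/eqP; rewrite eq_le.
have lb : lbound [set lagrangian f0 f x lam | x in X] (lagrangian f0 f y lam).
  by move=> _ [z Xz <-]; exact: ymin.
apply/andP; split.
  by apply: ge_inf; [exists (lagrangian f0 f y lam) | exists y].
by apply: lb_le_inf => //; exists (lagrangian f0 f y lam), y.
Qed.

Lemma dual_le (R : realType) (n m : nat) (X : set 'rV[R]_n)
    (f0 : 'rV[R]_n -> R) (f : 'I_m -> 'rV[R]_n -> R) (lam : 'rV[R]_m)
    (y z : 'rV[R]_n) :
  is_argmin X (fun x => lagrangian f0 f x lam) y -> X z ->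
  dual X f0 f lam <= f0 z + dotv lam (fvec f z).
Proof.
move=> ymin Xz; rewrite (dual_argmin ymin) -!lagrangianE.
by case: ymin => _; apply.
Qed.

(** The minimizer at [a] is a trial point at [b] and the Lagrangian is affine in the multiplier, so
    [fvec f xa] is a supergradient of the concave dual. *)
Lemma dual_le_linear (R : realType) (n m : nat) (X : set 'rV[R]_n)
    (f0 : 'rV[R]_n -> R) (f : 'I_m -> 'rV[R]_n -> R) (a b : 'rV[R]_m)
    (xa xb : 'rV[R]_n) :
  is_argmin X (fun x => lagrangian f0 f x a) xa ->
  is_argmin X (fun x => lagrangian f0 f x b) xb ->
  dual X f0 f b <= dual X f0 f a + dotv (fvec f xa) (b - a).
Proof.
move=> amin bmin; have Xa : X xa by case: amin.
apply: (le_trans (dual_le bmin Xa)).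
by rewrite (dual_argmin amin) !dotvE (dotvC b) (dotvC a); lra.
Qed.

(* Using the minimizer at b as a trial point at a gives the descent inequality
   with constant L instead of L / 2, without integrating the gradient. *)
Lemma dual_ge_quadratic (R : realType) (n m : nat) (X : set 'rV[R]_n)
    (f0 : 'rV[R]_n -> R) (f : 'I_m -> 'rV[R]_n -> R) (L : R) (a b : 'rV[R]_m)
    (xa xb : 'rV[R]_n) :
  is_argmin X (fun x => lagrangian f0 f x a) xa ->
  is_argmin X (fun x => lagrangian f0 f x b) xb ->
  norm2 (fvec f xa - fvec f xb) <= L * norm2 (b - a) ->
  dual X f0 f a + dotv (fvec f xa) (b - a) - L * dotv (b - a) (b - a)
    <= dual X f0 f b.
Proof.
move=> amin bmin lip; have := dual_le_linear bmin amin.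
have := ler_dotv_norm2 (fvec f xa - fvec f xb) (b - a).
have := ler_wpM2r (norm2_ge0 (b - a)) lip.
rewrite -mulrA -expr2 norm2_sqr (dotvDl (fvec f xa)) dotvNl.
have -> : dotv (fvec f xb) (a - b) = - dotv (fvec f xb) (b - a).
  by rewrite -dotvNr opprB.
lra.
Qed.

(** * Gradients relative to the orthant *)

(** From every point of the orthant, boundary included, the coordinate directions point inwards, so
    one-sided difference quotients determine each entry of a gradient. *)
Lemma is_gradient_uniq (R : realType) (m : nat) (h : 'rV[R]_m -> R)
    (a g g' : 'rV[R]_m) :
  orthant a -> is_gradient (@orthant R m) h a g ->
  is_gradient (@orthant R m) h a g' -> g = g'.
Proof.
move=> a0 hg hg'; apply/rowP => i.
apply/eqP; rewrite -subr_eq0 -normr_eq0 -[_ == 0]negbK; apply/negP => gg'.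
have gp : 0 < `|g ord0 i - g' ord0 i| by rewrite lt_def gg' normr_ge0.
set d := `| _ | in gp.
pose w : 'rV[R]_m := delta_mx ord0 i.
have wE v : dotv v w = v ord0 i.
  rewrite /dotv (bigD1 i) //= big1 ?addr0 => [|j ji]; rewrite mxE eqxx.
    by rewrite eqxx mulr1.
  by rewrite (negbTE ji) mulr0.
have near_t : \forall t \near (0 : R)^'+, orthant (a + t *: w) ->
   `|h (a + t *: w) - h a - dotv g (t *: w)| <= d / 4 * norm2 (t *: w) /\
   `|h (a + t *: w) - h a - dotv g' (t *: w)| <= d / 4 * norm2 (t *: w).
  have cvga : (fun t : R => a + t *: w) @ (0 : R)^'+ --> a.
    rewrite -[X in _ --> X]addr0 -(scale0r w).
    apply: cvgD; first exact: cvg_cst.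
    by apply: cvgZr_tmp; apply: cvg_at_right_filter; exact: cvg_id.
  have d4 : 0 < d / 4 by rewrite divr_gt0.
  near=> t => ot.
  have /(_ ot) H1 : orthant (a + t *: w) -> `|h (a + t *: w) - h a - dotv g (a + t *: w - a)|
     <= d / 4 * norm2 (a + t *: w - a) by near: t; exact: (cvga _ (hg _ d4)).
  have /(_ ot) H2 : orthant (a + t *: w) -> `|h (a + t *: w) - h a - dotv g' (a + t *: w - a)|
     <= d / 4 * norm2 (a + t *: w - a) by near: t; exact: (cvga _ (hg' _ d4)).
  by rewrite (addrC a) addrK -(addrC a) in H1 H2.
have [t [t0]] : exists t : R, 0 < t /\ (orthant (a + t *: w) ->
   `|h (a + t *: w) - h a - dotv g (t *: w)| <= d / 4 * norm2 (t *: w) /\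
   `|h (a + t *: w) - h a - dotv g' (t *: w)| <= d / 4 * norm2 (t *: w)).
  near (0 : R)^'+ => t; exists t; split => //; near: t; exact: near_t.
have ot : orthant (a + t *: w).
  move=> j; rewrite !mxE; apply: addr_ge0; first exact: a0.
  by rewrite mulr_ge0 ?ler0n ?(ltW t0).
have nw : norm2 (t *: w) = t.
  apply/eqP; rewrite -(@eqrXn2 _ 2) ?norm2_ge0 ?(ltW t0) // norm2_sqr.
  by rewrite !dotvE wE mxE !eqxx mulr1.
move=> /(_ ot); rewrite nw !dotvZr !wE => -[H1 H2].
have : `|t * g ord0 i - t * g' ord0 i| <= d / 2 * t.
  move: H1 H2; rewrite !ler_norml; lra.
rewrite -mulrBr normrM (gtr0_norm t0) -/d; nra.
Unshelve. all: by end_near. Qed.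

(** The penalty differs from its linearization by exactly [mu / 2 * norm2 (b - a) ^+ 2], which is of
    second order; uniqueness then identifies the value chosen by [xget]. *)
Lemma gradient_dual_mu (R : realType) (n m : nat) (X : set 'rV[R]_n)
    (f0 : 'rV[R]_n -> R) (f : 'I_m -> 'rV[R]_n -> R) (mu : R)
    (a g : 'rV[R]_m) :
  0 < mu -> orthant a -> is_gradient (@orthant R m) (dual X f0 f) a g ->
  gradient (@orthant R m) (dual_mu X f0 f mu) a = g - mu *: a.
Proof.
move=> mu0 oa hg.
have hgmu : is_gradient (@orthant R m) (dual_mu X f0 f mu) a (g - mu *: a).
  move=> e e0; have e2 : 0 < e / 2 by rewrite divr_gt0.
  have small : \forall b \near a, mu / 2 * norm2 (b - a) <= e / 2.
    (* Neighbourhoods are taken in the sup norm, hence the factor [Num.sqrt m%:R]; the [+ 1] keeps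
       the denominator positive for [m = 0]. *)
    pose r := e / (mu * (Num.sqrt m%:R + 1)).
    have s0 : 0 <= Num.sqrt m%:R :> R by exact: sqrtr_ge0.
    have r0 : 0 < r by rewrite divr_gt0 // mulr_gt0 //; lra.
    have : \forall b \near a, `|a - b| < r by apply/nbhs_normP; exists r.
    apply: filterS => b /ltW abr.
    have nb : norm2 (b - a) <= Num.sqrt m%:R * r.
      apply: norm2_le (ltW r0) _ => i.
      rewrite -[b - a]opprB mxE normrN; apply: le_trans abr.
      by rewrite [leRHS]mx_normrE; apply: (le_bigmax _ (fun ij => `|(a - b) ij.1 ij.2|) (ord0, i)).
    have er : e = mu * (Num.sqrt m%:R * r + r).
      rewrite /r; field; rewrite gt_eqF //=; apply: lt0r_neq0; lra.
    nra.
  near=> b => ob.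
  have /(_ ob) H : orthant b -> `|dual X f0 f b - dual X f0 f a - dotv g (b - a)|
     <= e / 2 * norm2 (b - a) by near: b; exact: hg.
  have sm : mu / 2 * norm2 (b - a) <= e / 2 by near: b.
  have -> : dual_mu X f0 f mu b - dual_mu X f0 f mu a
       - dotv (g - mu *: a) (b - a) =
     (dual X f0 f b - dual X f0 f a - dotv g (b - a))
       - mu / 2 * norm2 (b - a) ^+ 2.
    by rewrite /dual_mu !norm2_sqr !dotvE (dotvC a b); field.
  have := ler_wpM2r (norm2_ge0 (b - a)) sm; rewrite -[mu / 2 * _ * _]mulrA -expr2 => sm2.
  have n0 : 0 <= mu / 2 * norm2 (b - a) ^+ 2.
    by rewrite mulr_ge0 ?sqr_ge0 // ltW // divr_gt0.
  move: H; rewrite !ler_norml; lra.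
rewrite /gradient; case: xgetP => [y _ hy|/(_ _ hgmu)//].
exact: is_gradient_uniq hgmu.
Unshelve. all: by end_near. Qed.

(** * One accelerated step *)

(** Here [db], [du], [dn] stand for the dual values at [lb], [u], [lb'], while [phi] and [g] are the
    exact and the computed gradient of the dual at [u]. The choice of [eta] gives
    [alpha * (mu + 1 / eta) = mu], so both distances to [z] enter with the weight [mu / 2] and the
    inequality becomes a recursion with factor [1 - alpha]. *)
Lemma accelerated_step (R : realType) (m : nat) (L mu alpha eta q db du dn : R)
    (l lb u l' lb' z phi g : 'rV[R]_m) :
  0 < alpha -> alpha < 1 -> 0 < mu -> mu = 2 * alpha ^+ 2 * (L + mu) ->
  q = alpha / (1 + alpha) -> eta = alpha / (mu * (1 - alpha)) ->
  u = (1 - q) *: lb + q *: l -> lb' = (1 - alpha) *: lb + alpha *: l' ->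
  db <= du + dotv phi (lb - u) ->
  du + dotv phi (lb' - u) - L * dotv (lb' - u) (lb' - u) <= dn ->
  dotv (g - mu *: u) z - mu / 2 * dotv (z - u) (z - u)
    - 1 / (2 * eta) * dotv (z - l) (z - l)
    + (mu + 1 / eta) / 2 * dotv (z - l') (z - l')
    <= dotv (g - mu *: u) l' - mu / 2 * dotv (l' - u) (l' - u)
       - 1 / (2 * eta) * dotv (l' - l) (l' - l) ->
  (1 - alpha) * (db - mu / 2 * dotv lb lb - mu / 2 * dotv (z - l) (z - l))
    + alpha * (du + dotv g (z - u) - mu / 2 * dotv z z - dotv (g - phi) (l' - u))
    <= dn - mu / 2 * dotv lb' lb' - mu / 2 * dotv (z - l') (z - l').
Proof.
move=> a0 a1 mu0 muL qE etaE uE lb'E Hc Hq H3.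
(* Eliminating [L] and [lb] lets [field] check the closing identity. *)
have LE : L = mu / (2 * alpha ^+ 2) - mu.
  rewrite {1}muL; field; exact: lt0r_neq0.
have lbE : lb = (1 + alpha) *: u - alpha *: l.
  have -> : (1 + alpha) *: u = lb + alpha *: l.
    rewrite uE scalerDr !scalerA qE.
    rewrite (_ : (1 + alpha) * (1 - _) = 1); last by field; lra.
    by rewrite scale1r (_ : (1 + alpha) * _ = alpha) //; field; lra.
  by rewrite addrK.
(* The three inequalities with weights 1, 1 - alpha and alpha add up to the
   claim, up to this nonnegative remainder. *)
have rem : 0 <= mu / 2 * dotv (lb' - u) (lb' - u)
    + (1 - alpha) * (mu / 2) * dotv (lb - u) (lb - u)
    + mu / 2 * alpha * (1 - alpha) * dotv (l - u) (l - u).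
  have m2 : 0 <= mu / 2 by lra.
  have am : 0 <= 1 - alpha by lra.
  by do 2?[apply: addr_ge0]; apply: mulr_ge0; rewrite ?dotvv_ge0 ?mulr_ge0 // ltW.
have Hc' : (1 - alpha) * db <= (1 - alpha) * (du + dotv phi (lb - u)).
  by rewrite ler_wpM2l // subr_ge0 ltW.
have H3' := ler_wpM2l (ltW a0) H3.
suff : forall A B C D E F G' H K : R, A <= B -> C <= D -> E <= F -> 0 <= G' ->
  K - H = (B - A) + (D - C) + (F - E) + G' -> H <= K.
  apply; [exact: Hq | exact: Hc' | exact: H3' | exact: rem |].
  rewrite lb'E lbE LE etaE !dotvE ?(dotvC l u) ?(dotvC l' u) ?(dotvC l' l)
    ?(dotvC z u) ?(dotvC z l) ?(dotvC z l').
  by field; rewrite !gt_eqF //; lra.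
move=> *; lra.
Qed.

(** * Geometric averages and the output distribution *)

(** The weights add up to [1 - (1 - alpha) ^+ T]: they are the output probabilities without the
    extra mass [(1 - alpha) ^+ T] at t = 1. *)
Definition wavg (R : realType) (alpha : R) (T : nat) (h : nat -> R) : R :=
  \sum_(1 <= t < T.+1) alpha * (1 - alpha) ^+ (T - t) * h t.

Lemma wavg0 (R : realType) (alpha : R) (h : nat -> R) : wavg alpha 0 h = 0.
Proof. by rewrite /wavg big_nil. Qed.

Lemma wavgS (R : realType) (alpha : R) (T : nat) (h : nat -> R) :
  wavg alpha T.+1 h = (1 - alpha) * wavg alpha T h + alpha * h T.+1.
Proof.
rewrite /wavg big_nat_recr //= subnn expr0 mulr1 mulr_sumr; congr (_ + _).
rewrite !big_nat; apply: eq_bigr => t /andP[_ tT].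
by rewrite subSn // exprS; ring.
Qed.

Lemma wavg_le (R : realType) (alpha : R) (T : nat) (h k : nat -> R) :
  0 <= alpha <= 1 -> (forall t, (t < T)%N -> h t.+1 <= k t.+1) ->
  wavg alpha T h <= wavg alpha T k.
Proof.
move=> /andP[a0 a1] hk; rewrite /wavg !big_nat; apply: ler_sum => -[//|t] /= tT.
by rewrite ler_wpM2l ?hk // mulr_ge0 ?exprn_ge0 ?subr_ge0.
Qed.

Lemma wavg_cst (R : realType) (alpha : R) (T : nat) (c : R) :
  wavg alpha T (fun=> c) = (1 - (1 - alpha) ^+ T) * c.
Proof.
elim: T => [|T IH]; first by rewrite wavg0 expr0 subrr mul0r.
by rewrite wavgS IH exprS; ring.
Qed.

Lemma wavgD (R : realType) (alpha : R) (T : nat) (h k : nat -> R) :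
  wavg alpha T (fun t => h t + k t) = wavg alpha T h + wavg alpha T k.
Proof.
by elim: T => [|T IH]; rewrite ?wavg0 ?addr0 // !wavgS IH; ring.
Qed.

Lemma wavgN (R : realType) (alpha : R) (T : nat) (h : nat -> R) :
  wavg alpha T (fun t => - h t) = - wavg alpha T h.
Proof.
by elim: T => [|T IH]; rewrite ?wavg0 ?oppr0 // !wavgS IH; ring.
Qed.

Lemma wavg_dotv (R : realType) (m : nat) (alpha : R) (T : nat) (l : 'rV[R]_m)
    (v : nat -> 'rV[R]_m) :
  wavg alpha T (fun t => dotv l (v t))
    = dotv l (\row_i wavg alpha T (fun t => v t ord0 i)).
Proof.
elim: T => [|T IH].
  by rewrite wavg0 [RHS]big1 // => i _; rewrite mxE wavg0 mulr0.
rewrite wavgS IH -!dotvZr -dotvDr; congr dotv.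
by apply/rowP => i; rewrite !mxE wavgS.
Qed.

Lemma wavg_recurrence (R : realType) (alpha : R) (T : nat) (a b : nat -> R) :
  alpha <= 1 ->
  (forall t, (t < T)%N -> (1 - alpha) * a t + alpha * b t.+1 <= a t.+1) ->
  (1 - alpha) ^+ T * a 0%N + wavg alpha T b <= a T.
Proof.
move=> a1; elim: T => [|T IH] ab; first by rewrite wavg0 expr0 mul1r addr0.
apply: le_trans (ab T (ltnSn T)).
have /(ler_wpM2l (_ : 0 <= 1 - alpha)) := IH (fun t tT => ab t (ltnW tT)).
rewrite subr_ge0 wavgS exprS => /(_ a1); lra.
Qed.

Lemma out_mean_wavg (R : realType) (n : nat) (alpha : R) (T : nat)
    (x : nat -> 'rV[R]_n) (h : 'rV[R]_n -> R^o) :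
  (0 < T)%N ->
  out_mean alpha T x h
    = wavg alpha T (fun t => h (x t)) + (1 - alpha) ^+ T * h (x 1%N).
Proof.
case: T => // T _; rewrite /out_mean /wavg !(@big_ltn _ _ _ 1) //.
rewrite /out_prob eqxx subn1 /= addrAC; congr (_ + _).
  by rewrite exprS /GRing.scale /=; ring.
rewrite !big_nat; apply: eq_bigr => t /andP[t1 _].
by rewrite gtn_eqF.
Qed.

Lemma out_mean_coord (R : realType) (n m : nat) (alpha : R) (T : nat)
    (x : nat -> 'rV[R]_n) (f : 'I_m -> 'rV[R]_n -> R) (i : 'I_m) :
  out_mean alpha T x (fvec f) ord0 i = out_mean alpha T x (f i : 'rV[R]_n -> R^o).
Proof. by rewrite /out_mean summxE; apply: eq_bigr => t _; rewrite !mxE. Qed.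

Lemma le_maxT (R : realType) (T t : nat) (g : nat -> R) :
  (t < T)%N -> g t.+1 <= maxT T g.
Proof.
by move=> tT; apply: (le_bigmax_seq _ t.+1 xpredT g) => //; rewrite mem_index_iota.
Qed.

Lemma maxT_ge0 (R : realType) (T : nat) (g : nat -> R) : 0 <= maxT T g.
Proof.
rewrite /maxT; elim/big_rec: _ => // t y _ y0.
by rewrite le_max y0 orbT.
Qed.

(** * Iterates of AR-CO and the regret inequality *)

(** Places all multipliers in the orthant, where Lagrangian minimizers and gradients are
    available. *)
Lemma AR_CO_box (R : realType) (n m : nat) (X : set 'rV[R]_n)
    (f0 : 'rV[R]_n -> R) (f : 'I_m -> 'rV[R]_n -> R)
    (mu alpha q eta B delta : R) (T : nat)
    (lam lamu lamb : nat -> 'rV[R]_m) (x : nat -> 'rV[R]_n) :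
  AR_CO_run X f0 f mu alpha q eta B delta T lam lamu lamb x ->
  0 <= B -> 0 <= alpha <= 1 -> 0 <= q <= 1 ->
  (forall t, (t <= T)%N -> dual_box B (lam t) /\ dual_box B (lamb t)) /\
  (forall t, (t < T)%N -> dual_box B (lamu t.+1)).
Proof.
move=> run B0 a01 q01.
have box t : (t <= T)%N -> dual_box B (lam t) /\ dual_box B (lamb t).
  elim: t => [_|t IH tT].
    by rewrite (run_lam0 run) (run_lamb0 run); split=> i; rewrite mxE lexx /= mulr_ge0.
  have [lt lbt] := IH (ltnW tT); have [lt1 _] := run_lam run tT.
  by split=> //; rewrite (run_lamb run tT); exact: dual_box_convex.
split=> // t tT; rewrite (run_lamu run tT).
by have [? ?] := box t (ltnW tT); exact: dual_box_convex.
Qed.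

(** The recursion is unrolled for fixed [z]. The initial potential and the averaged gains together
    contribute [- (mu / 2 * dotv z z)], which cancels against the final distance from [z] to
    [lam T]; what remains is affine in [z], and the cross term produces [- mu *: lam T]. *)
Lemma AR_CO_regret (R : realType) (n m : nat) (X : set 'rV[R]_n)
    (f0 : 'rV[R]_n -> R) (f : 'I_m -> 'rV[R]_n -> R)
    (L mu alpha q eta B delta : R) (T : nat)
    (lam lamu lamb : nat -> 'rV[R]_m) (x : nat -> 'rV[R]_n)
    (xs : 'rV[R]_m -> 'rV[R]_n) (z : 'rV[R]_m) :
  AR_CO_run X f0 f mu alpha q eta B delta T lam lamu lamb x ->
  (forall l, orthant l -> is_argmin X (fun y => lagrangian f0 f y l) (xs l)) ->
  (forall l l', orthant l -> orthant l' ->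
     norm2 (fvec f (xs l) - fvec f (xs l')) <= L * norm2 (l - l')) ->
  0 <= B -> 0 < alpha -> alpha < 1 -> 0 < mu ->
  mu = 2 * alpha ^+ 2 * (L + mu) -> q = alpha / (1 + alpha) ->
  eta = alpha / (mu * (1 - alpha)) -> dual_box B z ->
  (1 - alpha) ^+ T * dual X f0 f 0
    + wavg alpha T (fun t => dual X f0 f (lamu t)
        - dotv (fvec f (x t)) (lamu t)
        - dotv (fvec f (x t) - fvec f (xs (lamu t))) (lam t - lamu t))
    + dotv z (\row_i wavg alpha T (fun t => f i (x t)) - mu *: lam T)
  <= dual_mu X f0 f mu (lamb T) - mu / 2 * dotv (lam T) (lam T).
Proof.
move=> run xsmin xslip B0 a0 a1 mu0 muE qE etaE zB.
have a01 : 0 <= alpha <= 1 by rewrite !ltW.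
have q01 : 0 <= q <= 1.
  by rewrite qE divr_ge0 ?ler_pdivrMr /=; lra.
have eta0 : 0 < eta by rewrite etaE divr_gt0 // mulr_gt0 // subr_gt0.
have [box boxu] := AR_CO_box run B0 a01 q01.
pose phi t := fvec f (xs (lamu t)).
pose b t := (dual X f0 f (lamu t) - dotv (fvec f (x t)) (lamu t)
        - dotv (fvec f (x t) - phi t) (lam t - lamu t))
  + dotv z (fvec f (x t)) + - (mu / 2 * dotv z z).
pose a t := dual X f0 f (lamb t) - mu / 2 * dotv (lamb t) (lamb t)
  - mu / 2 * dotv (z - lam t) (z - lam t).
have step t : (t < T)%N -> (1 - alpha) * a t + alpha * b t.+1 <= a t.+1.
  move=> tT.
  have [lB lbB] := box t (ltnW tT); have [l'B lb'B] := box t.+1 tT.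
  have uB := boxu t tT.
  have oE := @dual_box_orthant R m B.
  have H1 := dual_le_linear (xsmin _ (oE _ uB)) (xsmin _ (oE _ lbB)).
  have lip : norm2 (phi t.+1 - fvec f (xs (lamb t.+1)))
      <= L * norm2 (lamb t.+1 - lamu t.+1).
    have -> : norm2 (lamb t.+1 - lamu t.+1) = norm2 (lamu t.+1 - lamb t.+1).
      congr Num.sqrt; apply: eq_bigr => i _.
      by rewrite !mxE -sqrrN opprB.
    exact: xslip (oE _ uB) (oE _ lb'B).
  have H2 := dual_ge_quadratic (xsmin _ (oE _ uB)) (xsmin _ (oE _ lb'B)) lip.
  have H3 := prox_three_point (@dual_box_convex R m B) zB mu0 eta0 (run_lam run tT).
  have := accelerated_step a0 a1 mu0 muE qE etaE (run_lamu run tT)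
    (run_lamb run tT) H1 H2 H3.
  rewrite -/(phi t.+1) /a /b.
  rewrite [dotv (fvec _ _) (z - _)]dotvDr dotvNr (dotvC _ z); lra.
have := wavg_recurrence (ltW a1) step.
rewrite /b !wavgD wavg_dotv wavg_cst /a (run_lam0 run) (run_lamb0 run).
have -> : \row_i wavg alpha T (fun t => fvec f (x t) ord0 i)
    = \row_i wavg alpha T (fun t => f i (x t)).
  by apply/rowP => i; rewrite !mxE; apply: eq_bigr => t _; rewrite mxE.
rewrite /dual_mu norm2_sqr subr0 dotv0l mulr0 subr0.
rewrite [dotv z (_ - _)]dotvDr [dotv z (- _)]dotvNr dotvZr.
rewrite [dotv (z - _) _](_ : _ = dotv z z - 2 * dotv z (lam T) + dotv (lam T) (lam T)).
  lra.
by rewrite !dotvE (dotvC (lam T) z); ring.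
Qed.

(** * Scalar inequalities behind the zeta terms *)

(** The square of the right side is at least [64 * s * r ^+ 2 * B * G], hence at least
    [16 * s ^+ 2]. In the application [r] is the square root of [m] and [z] is [zeta]. *)
Lemma primal_error_le (R : realType) (r G B eta s z : R) :
  0 <= r -> 0 <= G -> 0 <= B -> 0 < eta -> 0 <= z -> 0 <= s ->
  s <= 4 * r ^+ 2 * B * G -> 4 * eta * s <= z ^+ 2 ->
  s <= z * (2 * r * G + 2 * r * B / eta).
Proof.
move=> r0 G0 B0 eta0 z0 s0 sle zs.
have w0 : 0 <= 2 * r * G + 2 * r * B / eta.
  by rewrite addr_ge0 ?divr_ge0 ?mulr_ge0 // ltW.
rewrite -(@ler_pXn2r _ 2) ?nnegrE ?mulr_ge0 // exprMn.
apply: (@le_trans _ _ (4 * eta * s * (2 * r * G + 2 * r * B / eta) ^+ 2)); last first.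
  by rewrite ler_wpM2r ?sqr_ge0.
(* AM-GM: (G + B / eta)^2 >= 4 G B / eta *)
have amgm : 16 * r ^+ 2 * B * G / eta <= (2 * r * G + 2 * r * B / eta) ^+ 2.
  rewrite -subr_ge0 [leRHS](_ : _ = (2 * r * G - 2 * r * B / eta) ^+ 2) ?sqr_ge0 //.
  by field; rewrite gt_eqF.
have h4 : 0 <= 4 * eta * s by rewrite mulr_ge0 // mulr_ge0 // ltW.
apply: le_trans (ler_wpM2l h4 amgm).
rewrite [leRHS](_ : _ = 16 * (s * (4 * r ^+ 2 * B * G))); last first.
  by field; rewrite gt_eqF.
have := ler_wpM2l s0 sle; rewrite expr2.
have := mulr_ge0 s0 s0; nra.
Qed.

(* Multiplying 2 B P <= xi h + s by P and using h P <= K + s gives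
   2 B P^2 <= xi (K + s) + s P, which eliminates h. *)
Lemma infeasibility_le (R : realType) (r G B xi eta s K h P z : R) :
  1 <= r -> 1 <= B -> G = B * xi -> 0 < xi -> 0 < eta -> 0 <= z -> 0 <= s ->
  0 <= K -> 0 <= P -> s <= 4 * r ^+ 2 * B * G -> 4 * eta * (s + K) <= z ^+ 2 ->
  h * P <= K + s -> 2 * B * P <= xi * h + s ->
  P <= z * (2 * r * xi + 2 * r / eta).
Proof.
move=> r1 B1 GE xi0 eta0 z0 s0 K0 P0 sle zs hP BP.
have r0 : 0 <= r by lra.
have w0 : 0 <= 2 * r * xi + 2 * r / eta.
  by rewrite addr_ge0 ?divr_ge0 ?mulr_ge0 // ltW.
set Z := _ * _; have Z0 : 0 <= Z by rewrite mulr_ge0.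
have Z2 : 64 * r ^+ 2 * xi * (s + K) <= Z ^+ 2.
  rewrite exprMn.
  apply: (@le_trans _ _ (4 * eta * (s + K) * (2 * r * xi + 2 * r / eta) ^+ 2)); last first.
    by rewrite ler_wpM2r ?sqr_ge0.
  have amgm : 16 * r ^+ 2 * xi / eta <= (2 * r * xi + 2 * r / eta) ^+ 2.
    rewrite -subr_ge0 [leRHS](_ : _ = (2 * r * xi - 2 * r / eta) ^+ 2) ?sqr_ge0 //.
    by field; rewrite gt_eqF.
  have h4 : 0 <= 4 * eta * (s + K) by rewrite mulr_ge0 ?addr_ge0 // mulr_ge0 // ltW.
  apply: le_trans (ler_wpM2l h4 amgm).
  rewrite le_eqVlt; apply/orP; left; apply/eqP.
  by field; rewrite gt_eqF.
rewrite leNgt; apply/negP => PZ.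
have Pp : 0 < P by lra.
have Z2P : Z ^+ 2 <= P ^+ 2 by rewrite ler_pXn2r ?nnegrE // ltW.
have xs0 : 0 <= xi * (s + K) by rewrite mulr_ge0 ?addr_ge0 // ltW.
have e1 : xi * (s + K) <= P ^+ 2 / 64.
  have r2 : 1 <= r ^+ 2 by rewrite expr_ge1.
  have := ler_wpM2r xs0 r2; lra.
(* [s ^+ 2] is at most [4 * B ^+ 2 * (r ^+ 2 * xi * s)], and [h1] bounds the bracket by
   [P ^+ 2 / 64]. *)
have e2 : s <= B * P / 4.
  have BP0 : 0 <= B * P / 4 by rewrite divr_ge0 ?mulr_ge0; lra.
  rewrite -(@ler_pXn2r _ 2) ?nnegrE //.
  have B2 : 0 <= B ^+ 2 by rewrite sqr_ge0.
  have sK : r ^+ 2 * xi * s <= r ^+ 2 * xi * (s + K).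
    by rewrite ler_wpM2l ?lerDl // mulr_ge0 ?sqr_ge0 // ltW.
  have h1 : 16 * (4 * (r ^+ 2 * xi * s)) <= P ^+ 2 by lra.
  have := ler_wpM2l B2 h1; have := ler_wpM2l s0 sle; rewrite GE !expr2; lra.
have h3 := ler_wpM2l (ltW Pp) BP.
have h4 := ler_wpM2l (ltW xi0) hP.
have h5 := ler_wpM2l (ltW Pp) e2.
have h6 : P ^+ 2 <= B * P ^+ 2 by rewrite ler_peMl ?sqr_ge0.
have h7 : 0 < P ^+ 2 by rewrite exprn_gt0.
have : 2 * (B * P ^+ 2) <= P ^+ 2 / 64 + B * P ^+ 2 / 4.
  move: h3 h4 h5 e1; rewrite expr2; lra.
lra.
Qed.

Theorem theorem2 (R : realType) (n m : nat) (X : set 'rV[R]_n)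
    (f0 : 'rV[R]_n -> R) (f : 'I_m -> 'rV[R]_n -> R)
    (G L xi mu Lt alpha q eta B delta : R) (T : nat)
    (lam lamu lamb : nat -> 'rV[R]_m) (x : nat -> 'rV[R]_n)
    (lam_mu : 'rV[R]_m)
    (X_neq0 : X !=set0) (X_closed : closed X) (X_convex : convex_set X)
    (f0_bounded : forall y, X y -> `|f0 y| <= G)
    (f_bounded : forall i y, X y -> `|f i y| <= G)
    (hduality : strong_duality X f0 f)
    (L_ge0 : 0 <= L) (hsmooth : dual_smooth X f0 f L)
    (hslater : slater X f xi)
    (mu_gt0 : 0 < mu) (delta_gt0 : 0 < delta) (T_gt0 : (0 < T)%N)
    (hLt : Lt = L + mu)
    (halpha : alpha = Num.sqrt (mu / (2 * Lt)))
    (hq : q = (2 * alpha - mu / Lt) / (2 - mu / Lt))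
    (heta : eta = alpha / (mu * (1 - alpha)))
    (hB : B = G / xi)
    (hrun : AR_CO_run X f0 f mu alpha q eta B delta T lam lamu lamb x)
    (hlam_mu : is_argmax (@orthant R m) (dual_mu X f0 f mu) lam_mu) :
  let Delta := fun t : nat =>
    dual X f0 f (lamu t) - f0 (x t) - dotv (lamu t) (fvec f (x t)) in
  let delt := fun t : nat =>
    nabla_hat f mu (x t) (lamu t)
    - gradient (@orthant R m) (dual_mu X f0 f mu) (lamu t) in
  let K0 := fun l : 'rV[R]_m =>
    dual_mu X f0 f mu l - dual_mu X f0 f mu (lamb 0%N)
    + alpha / 2 * (mu + 1 / eta) * norm2 (lam 0%N - l) ^+ 2 in
  let zeta :=
    2 * (1 - Num.sqrt (mu / (2 * Lt))) `^ (T%:R / 2)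
      * Num.sqrt (eta * K0 lam_mu)
    + Num.sqrt (8 * eta * Num.sqrt m%:R * G / xi
                * maxT T (fun t => norm2 (delt t))) in
  out_mean alpha T x (f0 : 'rV[R]_n -> R^o) - primal_opt X f0 f
    <= zeta * (2 * Num.sqrt m%:R * G + 2 * Num.sqrt m%:R * G / (eta * xi))
       + Num.sqrt (2 * Lt / mu) * maxT T (fun t => `|Delta t|)
       + 6 * mu * m%:R * G ^+ 2 / xi ^+ 2
  /\
  norm1 (pospart (out_mean alpha T x (fvec f)))
    <= zeta * (2 * Num.sqrt m%:R * xi + 2 * Num.sqrt m%:R / eta)
       + Num.sqrt (2 * Lt / mu) * (maxT T (fun t => `|Delta t|) / B)
       + 6 * mu * m%:R * G / xi
       + 2 * m%:R * G * (1 - Num.sqrt (mu / (2 * Lt))) ^+ (T - 1).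
Proof.

(* Parameters and oracle errors *)
move=> Delta delt K0 zeta.
case: hsmooth => xs [xsu xsg xslip].
have xsmin l (ol : orthant l) := proj1 (xsu l ol).
case: hslater => xi0 [xx Xxx fxx].
have G0 : 0 <= G by case: X_neq0 => y Xy; exact: le_trans (normr_ge0 _) (f0_bounded _ Xy).
have B0 : 0 <= B by rewrite hB divr_ge0 // ltW.
have GE : G = B * xi by rewrite hB divfK // gt_eqF.
have Lt0 : mu <= Lt by rewrite hLt lerDr.
have Ltp : 0 < Lt by exact: lt_le_trans Lt0.
have aa : alpha ^+ 2 = mu / (2 * Lt).
  by rewrite halpha sqr_sqrtr // divr_ge0 ?mulr_ge0 // ltW.
have a0 : 0 < alpha by rewrite halpha sqrtr_gt0 divr_gt0 ?mulr_gt0.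
have a2 : alpha ^+ 2 <= 1 / 2.
  rewrite aa ler_pdivrMr ?mulr_gt0 //; lra.
have a1 : alpha < 1 by nra.
have muLt : mu / Lt = 2 * alpha ^+ 2 by rewrite aa; field; rewrite gt_eqF.
have muE : mu = 2 * alpha ^+ 2 * (L + mu) by rewrite -muLt -hLt divfK // gt_eqF.
have qE : q = alpha / (1 + alpha).
  have a1' : 0 < 1 - alpha by lra.
  rewrite hq muLt (_ : 2 - 2 * alpha ^+ 2 = 2 * ((1 - alpha) * (1 + alpha))); last by ring.
  by field; apply/andP; split; apply: lt0r_neq0; lra.
have eta0 : 0 < eta by rewrite heta divr_gt0 // mulr_gt0 // subr_gt0.
have a01 : 0 <= alpha <= 1 by rewrite !ltW.
have am01 : 0 <= 1 - alpha <= 1 by rewrite subr_ge0 gerBl !ltW.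
have [am0 am1] := andP am01.
have q01 : 0 <= q <= 1.
  by rewrite qE divr_ge0 ?ler_pdivrMr /=; move: a0; clear; lra.
rewrite -halpha.
have -> : Num.sqrt (2 * Lt / mu) = alpha^-1.
  by rewrite halpha -sqrtrV ?divr_ge0 ?mulr_ge0 ?invf_div // ltW.
have ainv : 1 <= alpha^-1 by rewrite invf_ge1 // ltW.
have [box boxu] := AR_CO_box hrun B0 a01 q01.
have oE := @dual_box_orthant R m B.
set r := Num.sqrt m%:R.
have r0 : 0 <= r by exact: sqrtr_ge0.
set D := maxT T (fun t => norm2 (delt t)).
have D0 : 0 <= D by exact: maxT_ge0.
(* The terms [mu *: lamu t.+1] of the two gradients cancel. *)
have deltE t : (t < T)%N ->
    delt t.+1 = fvec f (x t.+1) - fvec f (xs (lamu t.+1)).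
  move=> tT; have ou := oE _ (boxu t tT).
  rewrite /delt (gradient_dual_mu mu_gt0 ou (xsg _ ou)) /nabla_hat.
  by rewrite opprB addrA subrK.
have DG : D <= r * (2 * G).
  rewrite /D /maxT big_nat; apply: bigmax_le.
    by rewrite !mulr_ge0.
  case=> // t /= tT; rewrite deltE //; apply: norm2_le; first by rewrite mulr_ge0.
  move=> i; rewrite !mxE (le_trans (ler_normB _ _)) //.
  have [Xx _] := run_x hrun tT.
  have [Xs _] := xsmin _ (oE _ (boxu t tT)).
  by have := f_bounded i _ Xx; have := f_bounded i _ Xs; lra.
(* By Cauchy-Schwarz, [s] bounds the gradient error paired with any vector whose entries are at most
   [2 * B] in absolute value, such as a difference of two box points. *)
pose s := 2 * r * B * D.
have s0 : 0 <= s by rewrite !mulr_ge0.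
have sle : s <= 4 * r ^+ 2 * B * G.
  have rB : 0 <= 2 * r * B by rewrite !mulr_ge0.
  by have := ler_wpM2l rB DG; rewrite /s expr2; lra.
have noise t (v : 'rV[R]_m) : (t < T)%N -> (forall i, `|v ord0 i| <= 2 * B) ->
    dotv (fvec f (x t.+1) - fvec f (xs (lamu t.+1))) v <= s.
  move=> tT vB; rewrite -deltE //; apply: (le_trans (ler_dotv_norm2 _ _)).
  rewrite (_ : s = D * (r * (2 * B))); last by rewrite /s; ring.
  apply: ler_pM; rewrite ?norm2_ge0 //.
    exact: (le_maxT (fun t => norm2 (delt t))).
  by apply: norm2_le; rewrite ?mulr_ge0.
have box_diff (u v : 'rV[R]_m) : dual_box B u -> dual_box B v ->
    forall i, `|(u - v) ord0 i| <= 2 * B.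
  by move=> uB vB i; have := uB i; have := vB i; rewrite !mxE ler_norml; clear; lra.

(* Dual bounds and the regularized maximizer *)
have box0 : dual_box B (0 : 'rV[R]_m) by move=> i; rewrite mxE lexx /= mulr_ge0.
have o0 := oE _ box0.
(* The Slater point serves as trial point. *)
have dual_ub (l : 'rV[R]_m) : orthant l -> dual X f0 f l <= G - xi * \sum_i l ord0 i.
  move=> ol; apply: (le_trans (dual_le (xsmin _ ol) Xxx)).
  apply: lerD; first by apply: le_trans (f0_bounded _ Xxx); exact: ler_norm.
  rewrite -mulrN1 mulrAC mulrN1 mulr_sumr; apply: ler_sum => i _.
  by rewrite mxE mulrC ler_wpM2r.
have dual_le_primal l : orthant l -> dual X f0 f l <= primal_opt X f0 f.
  move=> ol; rewrite hduality; apply: ub_le_sup; last by exists l.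
  exists G => _ [l' ol' <-]; apply: (le_trans (dual_ub _ ol')).
  by rewrite gerBl mulr_ge0 ?(ltW xi0) // sumr_ge0.
have dual0 : - G <= dual X f0 f 0.
  have [X0 _] := xsmin _ o0; have := f0_bounded _ X0.
  by rewrite (dual_argmin (xsmin _ o0)) dotv0l addr0 ler_norml => /andP[].
have [olm lm_max] := hlam_mu.
set N := \sum_i lam_mu ord0 i.
(* The quadratic term of [K0] has coefficient [mu / 2] and cancels the regularization. *)
have K0E : K0 lam_mu = dual X f0 f lam_mu - dual X f0 f 0.
  rewrite /K0 /dual_mu (run_lam0 hrun) (run_lamb0 hrun) !norm2_sqr sub0r.
  rewrite !dotvE !dotv0l heta.
  by field; rewrite !lt0r_neq0 // subr_gt0.
have lm_ge : dual X f0 f 0 <= dual_mu X f0 f mu lam_mu.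
  by have := lm_max _ o0; rewrite /dual_mu [X in _ - _ * X]norm2_sqr dotv0l mulr0 subr0.
have lm2 : 0 <= mu / 2 * dotv lam_mu lam_mu.
  by rewrite mulr_ge0 ?dotvv_ge0 // divr_ge0 // ltW.
have K00 : 0 <= K0 lam_mu.
  by rewrite K0E; move: lm_ge lm2; rewrite /dual_mu norm2_sqr; clear; lra.
have lm_ub := dual_ub _ olm.
have lmN i : lam_mu ord0 i <= N.
  by rewrite /N (bigD1 i) //= lerDl sumr_ge0.
(* [- G <= dual X f0 f 0 <= dual_mu X f0 f mu lam_mu <= G - xi * N], and [G = xi * B]. *)
have NB : N <= 2 * B.
  rewrite -(ler_pM2l xi0); move: lm_ge lm_ub; rewrite /dual_mu norm2_sqr -/N.
  by rewrite (_ : xi * (2 * B) = 2 * G); [lra | rewrite GE; ring].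
have lmB : dual_box B lam_mu.
  by move=> i; rewrite olm /= (le_trans (lmN i)).
pose K := (1 - alpha) ^+ T * K0 lam_mu.
have p0 : 0 <= (1 - alpha) ^+ T by rewrite exprn_ge0.
have KK0 : 0 <= K by rewrite mulr_ge0.
have zetaE : zeta = 2 * (1 - alpha) `^ (T%:R / 2) * Num.sqrt (eta * K0 lam_mu)
    + Num.sqrt (8 * eta * r * G / xi * D) by rewrite /zeta -halpha.
have zeta0 : 0 <= zeta.
  by rewrite zetaE addr_ge0 ?mulr_ge0 ?sqrtr_ge0 ?powR_ge0.
(* The two summands of [zeta] have squares [4 * eta * K] and [4 * eta * s]; the cross term is
   nonnegative. *)
have zeta2 : 4 * eta * (s + K) <= zeta ^+ 2.
  set A := 2 * _ * _ in zetaE; set C := Num.sqrt _ in zetaE.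
  have A0 : 0 <= A by rewrite /A !mulr_ge0 ?sqrtr_ge0 ?powR_ge0.
  have C0 : 0 <= C by exact: sqrtr_ge0.
  have A2 : A ^+ 2 = 4 * eta * K.
    rewrite /A !exprMn sqr_sqrtr ?mulr_ge0 ?(ltW eta0) //.
    rewrite -(powR_mulrn _ (powR_ge0 _ _)) -powRrM divfK ?pnatr_eq0 //.
    by rewrite powR_mulrn ?subr_ge0 ?(ltW a1) // /K; ring.
  have C2 : C ^+ 2 = 4 * eta * s.
    rewrite /C sqr_sqrtr; first by rewrite /s hB; field; rewrite gt_eqF.
    by rewrite !mulr_ge0 ?invr_ge0 // ltW.
  rewrite zetaE sqrrD A2 C2.
  by have := mulr_ge0 A0 C0; clear; lra.
have regret v (vB : dual_box B v) :=
  AR_CO_regret hrun xsmin xslip B0 a0 a1 mu_gt0 muE qE heta vB.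
set W := wavg alpha T _ in regret.
set F := \row_i wavg _ _ _ in regret.
have lT2 : 0 <= mu / 2 * dotv (lam T) (lam T).
  by rewrite mulr_ge0 ?dotvv_ge0 // divr_ge0 // ltW.
have [lTB lbTB] := box T (leqnn T).
have olbT := oE _ lbTB.
set MD := maxT T (fun t => `|Delta t|).
have MD0 : 0 <= MD by exact: maxT_ge0.
have lamu1 : lamu 1%N = 0.
  by rewrite (run_lamu hrun T_gt0) (run_lam0 hrun) (run_lamb0 hrun) !scaler0 addr0.

(* Bound on the objective *)
split.
  have DM t : (t < T)%N -> - MD <= Delta t.+1.
    move=> tT; have := le_maxT (fun t => `|Delta t|) tT; rewrite -/MD => DMt.
    by have := lerNnormlW DMt.
  have sz : s <= zeta * (2 * r * G + 2 * r * G / (eta * xi)).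
    rewrite [2 * r * G / _](_ : _ = 2 * r * B / eta); last first.
      by rewrite hB; field; rewrite !gt_eqF.
    apply: primal_error_le => //.
    by apply: le_trans zeta2; rewrite ler_wpM2l ?lerDl // mulr_ge0 // ltW.
  have WF : wavg alpha T (fun t => f0 (x t))
      + (1 - (1 - alpha) ^+ T) * (- MD - s) <= W.
    rewrite -wavg_cst -wavgD; apply: wavg_le => // t tT.
    have := DM _ tT; rewrite /Delta (dotvC (lamu _)).
    have [ltB _] := box _ tT.
    by have := noise _ _ tT (box_diff _ _ ltB (boxu _ tT)); clear; lra.
  (* As [lamu 1] is 0, this bounds [f0 (x 1)] by [dual X f0 f 0 + MD], which pays for the extra mass
     at [x 1] through the first term of the regret. *)
  have D1 := DM _ T_gt0; rewrite /Delta lamu1 dotv0l subr0 in D1.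
  have reg := regret _ box0; rewrite dotv0l addr0 in reg.
  have lb2 : 0 <= mu / 2 * dotv (lamb T) (lamb T).
    by rewrite mulr_ge0 ?dotvv_ge0 // divr_ge0 // ltW.
  have dp := dual_le_primal _ olbT.
  rewrite /dual_mu norm2_sqr in reg.
  have D1' := ler_wpM2l p0 D1.
  have ps : 0 <= (1 - alpha) ^+ T * s by rewrite mulr_ge0.
  have aMD : MD <= alpha^-1 * MD by rewrite ler_peMl.
  have rest : 0 <= 6 * mu * m%:R * G ^+ 2 / xi ^+ 2.
    by rewrite divr_ge0 ?sqr_ge0 // !mulr_ge0 ?ler0n ?sqr_ge0 // ltW.
  rewrite out_mean_wavg //.
  by move: sz WF D1' reg lb2 lT2 dp ps aMD rest; clear; lra.

(* Bound on the constraint violation *)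
have T1 : (1 - alpha) ^+ T <= (1 - alpha) ^+ (T - 1).
  by rewrite ler_wiXn2l ?leq_subr.
have MDB : 0 <= alpha^-1 * (MD / B) by rewrite !mulr_ge0 ?invr_ge0 // ltW.
have zr0 : 0 <= zeta * (2 * r * xi + 2 * r / eta).
  by rewrite mulr_ge0 // addr_ge0 ?divr_ge0 ?mulr_ge0 // ltW.
have mB0 : 0 <= mu * m%:R * B by rewrite !mulr_ge0 ?ler0n // ltW.
have muB : 6 * mu * m%:R * G / xi = 6 * (mu * m%:R * B) by rewrite hB; ring.
have mG : m%:R * G * (1 - alpha) ^+ T <= m%:R * G * (1 - alpha) ^+ (T - 1).
  by rewrite ler_wpM2l ?mulr_ge0 ?ler0n.
have mG0 : 0 <= m%:R * G * (1 - alpha) ^+ T by rewrite !mulr_ge0 ?ler0n.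
rewrite pospart_sumE muB.
have [m0|m_gt0] := posnP m.
  rewrite big1 => [|i _]; last by have := ltn_ord i; rewrite {2}m0.
  by move: zr0 MDB mB0 mG mG0; clear; lra.
have FE i : F ord0 i = wavg alpha T (fun t => f i (x t)) by rewrite mxE.
(* In each summand of [W] the terms in [lamu t] cancel after [dual X f0 f (lamu t)] is bounded below
   by the supergradient inequality towards [lam_mu], respectively written out at its minimizer. Only
   the gradient error is left, so [Delta] does not enter. *)
have [WE1 WE2] : (1 - (1 - alpha) ^+ T) * dual X f0 f lam_mu - dotv lam_mu F - s <= W
    /\ (1 - (1 - alpha) ^+ T) * (- G - s) <= W.
  split.
    have ps : 0 <= (1 - alpha) ^+ T * s by rewrite mulr_ge0.
    have -> : dotv lam_mu F = wavg alpha T (fun t => dotv lam_mu (fvec f (x t))).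
      rewrite wavg_dotv; congr dotv; apply/rowP => i.
      by rewrite FE mxE; apply: eq_bigr => t _; rewrite mxE.
    apply: (@le_trans _ _ (wavg alpha T (fun t => dual X f0 f lam_mu - s
      + - dotv lam_mu (fvec f (x t))))).
      by rewrite wavgD wavg_cst wavgN; move: ps; clear; lra.
    apply: wavg_le => // t tT; have ou := oE _ (boxu _ tT).
    have [ltB _] := box _ tT.
    have := noise _ _ tT (box_diff _ _ ltB lmB).
    have := dual_le_linear (xsmin _ ou) (xsmin _ olm).
    by rewrite !dotvE !(dotvC lam_mu); clear; lra.
  rewrite -wavg_cst; apply: wavg_le => // t tT; have ou := oE _ (boxu _ tT).
  have [ltB _] := box _ tT; have [Xs _] := xsmin _ ou.
  have ltB' i : `|lam t.+1 ord0 i| <= 2 * B.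
    by rewrite -[lam _]subr0; exact: box_diff.
  have := noise _ _ tT ltB'; have := f0_bounded _ Xs.
  rewrite (dual_argmin (xsmin _ ou)) ler_norml => /andP[+ _].
  by rewrite !dotvE (dotvC (lamu _)); clear; lra.
pose Q := F - mu *: lam T; rewrite -/Q in regret.
have QE : F = Q + mu *: lam T by rewrite subrK.
clearbody Q.
pose P := \sum_i Num.max (Q ord0 i) 0.
have maxQ i : 0 <= Num.max (Q ord0 i) 0 by rewrite le_max lexx orbT.
have P0 : 0 <= P by exact: sumr_ge0.
(* At the Slater point a constraint value is at most [- xi] and at least [- G]. *)
have B1 : 1 <= B.
  rewrite hB ler_pdivlMr // mul1r.
  have := f_bounded (Ordinal m_gt0) _ Xxx; have := fxx (Ordinal m_gt0).
  by rewrite ler_norml; clear; lra.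
have r1 : 1 <= r by rewrite -sqrtr1 ler_sqrt ?ler0n // ler1n.
have dmuT : dual_mu X f0 f mu (lamb T) <= dual_mu X f0 f mu lam_mu by exact: lm_max.
(* P is the excess of F over mu * lam T.  It is tested against two points of the
   box: lam_mu, raised to 2 * B on the support of P, which compares with the
   dual value at lam_mu, and 2 * B on the support of P only, which uses
   f0 >= - G.  The slack 2 * B - N of lam_mu enters with opposite effects. *)
have hP : (2 * B - N) * P <= K + s.
  pose v : 'rV[R]_m := \row_i if 0 < Q ord0 i then 2 * B else lam_mu ord0 i.
  have vB : dual_box B v.
    by move=> i; rewrite mxE; case: ifP => _; rewrite ?lexx ?mulr_ge0.
  have vQ : (2 * B - N) * P <= dotv (v - lam_mu) Q.
    rewrite mulr_sumr; apply: ler_sum => i _; rewrite !mxE.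
    case: ltP => [Qi|Qi]; last by rewrite mulr0 subrr mul0r.
    by rewrite ler_wpM2r ?lerB ?(ltW Qi).
  (* Two squared norms from the regret and the cross term from [mu *: lam T] in [F] complete this
     square. *)
  have sq : 0 <= mu / 2 * dotv (lam_mu - lam T) (lam_mu - lam T).
    by rewrite mulr_ge0 ?dotvv_ge0 // divr_ge0 // ltW.
  move: vQ sq WE1 (regret _ vB) dmuT; rewrite /K K0E QE /dual_mu !norm2_sqr.
  by rewrite !dotvE (dotvC (lam T) lam_mu); clear; lra.
have BP : 2 * B * P <= xi * (2 * B - N) + s.
  pose v : 'rV[R]_m := \row_i if 0 < Q ord0 i then 2 * B else 0.
  have vB : dual_box B v.
    by move=> i; rewrite mxE; case: ifP => _; rewrite ?lexx ?mulr_ge0.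
  have vQ : 2 * B * P = dotv v Q.
    rewrite mulr_sumr; apply: eq_bigr => i _; rewrite !mxE.
    by case: ltP => // _; rewrite mulr0 mul0r.
  have pd := ler_wpM2l p0 dual0.
  have ps : 0 <= (1 - alpha) ^+ T * s by rewrite mulr_ge0.
  rewrite vQ; move: WE2 (regret _ vB) dmuT lm_ub; rewrite /dual_mu !norm2_sqr -/N GE.
  by move: pd ps lT2 lm2; rewrite GE; clear; lra.
have PZ := infeasibility_le r1 B1 GE xi0 eta0 zeta0 s0 KK0 P0 sle zeta2 hP BP.
(* Entry [i] of the output mean is [Q ord0 i + mu * lam T ord0 i + (1 - alpha) ^+ T * f i (x 1)];
   the last two terms are at most [2 * mu * B] and [(1 - alpha) ^+ T * G]. *)
have outP : \sum_i Num.max (out_mean alpha T x (fvec f) ord0 i) 0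
  <= P + (2 * (mu * m%:R * B) + m%:R * G * (1 - alpha) ^+ T).
  rewrite [X in _ <= P + X](_ : _ =
      \sum_(i < m) (mu * (2 * B) + (1 - alpha) ^+ T * G)); last first.
    by rewrite sumr_const card_ord -mulr_natl; ring.
  rewrite -big_split; apply: ler_sum => i _ /=.
  rewrite out_mean_coord out_mean_wavg // -FE QE !mxE.
  have /andP[l0 l1] := lTB i.
  have ml0 : 0 <= mu * lam T ord0 i by rewrite mulr_ge0 // ltW.
  have ml1 : mu * lam T ord0 i <= mu * (2 * B) by rewrite ler_wpM2l // ltW.
  have [Xx1 _] := run_x hrun T_gt0.
  have fx1 : f i (x 1%N) <= G by apply: le_trans (f_bounded i _ Xx1); exact: ler_norm.
  have pf := ler_wpM2l p0 fx1.
  have pG : 0 <= (1 - alpha) ^+ T * G by rewrite mulr_ge0.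
  have Qmax : Q ord0 i <= Num.max (Q ord0 i) 0 by rewrite le_max lexx.
  have Qmax0 := maxQ i.
  rewrite ge_max; apply/andP.
  by move: Qmax Qmax0 ml0 ml1 pf pG; clear; split; lra.
by move: PZ outP MDB mB0 mG mG0; clear; lra.
Qed.
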